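(* Let $X$ be a finite set and let $H$ be a non-trivial hypergraph on vertex set $X$ (i.e. $H\neq\emptyset$ and $\emptyset\notin H$). Then \[p_c(H)\le 8\,q(H)\log_2(2\ell(H)).\]
   Context: A hypergraph $H$ on a finite vertex set $X$ is a collection of subsets of $X$, called hyperedges. The upward closure of a hypergraph $G$ on $X$ is $\langle G\rangle=\{R\subseteq X:\exists\, S\in G\text{ such that }S\subseteq R\}$. For $q\in(0,1)$, $H$ is called $q$-small if there is a hypergraph $G$ on $X$ such that $H\subseteq\langle G\rangle$ and $\sum_{R\in G}q^{|R|}\le\frac12$ (here $G$ is allowed to contain the empty set, which contributes $q^0=1$). $q(H)$ denotes the maximum $q$ such that $H$ is $q$-small. $\ell(H)$ denotes the size of the largest hyperedge of $H$. For $p\in[0,1]$, $X_p$ denotes a random subset of $X$ in which each element is included independently with probability $p$. $p_c(H)$ denotes the unique $p\in[0,1]$ such that $\mathbb{P}(\exists\, S\in H\text{ such that }S\subseteq X_p)=\frac12$ (it exists and is unique by monotonicity, for non-trivial $H$). *)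

(* Defs.v *)
From mathcomp Require Import all_boot all_order all_algebra.
From mathcomp Require Import all_classical all_reals all_analysis.
From mathcomp Require Import ring lra.

Set Implicit Arguments.
Unset Strict Implicit.
Unset Printing Implicit Defensive.

Import Order.TTheory GRing.Theory Num.Theory.
Import numFieldNormedType.Exports.
Local Open Scope ring_scope.

Definition upclosure (X : finType) (G : {set {set X}}) : {set {set X}} :=
  [set R : {set X} | [exists S in G, S \subset R]]%SET.

Definition nontrivial (X : finType) (H : {set {set X}}) : bool :=
  (H != finset.set0) && (finset.set0 \notin H).

Definition ell (X : finType) (H : {set {set X}}) : nat := \max_(S in H) #|S|.

Definition q_small (R : realType) (X : finType) (H : {set {set X}}) (q : R) :
    Prop :=
  exists G : {set {set X}},
    H \subset upclosure G /\ \sum_(S in G) q ^+ #|S| <= 2^-1.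

(* For nontrivial H this supremum is a maximum: see q_expectationP. *)
Definition q_expectation (R : realType) (X : finType) (H : {set {set X}}) : R :=
  sup [set q : R | 0 < q < 1 /\ q_small H q]%classic.

(* Law of the random subset of X that contains each element independently with
   probability p. *)
Definition subset_law (R : realType) (X : finType) (p : R) (A : {set X}) : R :=
  \prod_(x : X) (if x \in A then p else 1 - p).

Definition subset_prob (R : realType) (X : finType) (p : R)
    (E : pred {set X}) : R :=
  \sum_(A : {set X} | E A) subset_law p A.

Definition contains_edge (X : finType) (H : {set {set X}}) : pred {set X} :=
  fun A => [exists S in H, S \subset A].

Definition is_threshold (R : realType) (X : finType) (H : {set {set X}})
    (p : R) : Prop :=
  0 <= p <= 1 /\ subset_prob p (contains_edge H) = 2^-1.

(* The default value 0 is irrelevant for nontrivial H, where the threshold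
   exists and is unique: see p_cP and threshold_unique. *)
Definition p_c (R : realType) (X : finType) (H : {set {set X}}) : R :=
  xget 0 [set p : R | is_threshold H p]%classic.

Definition log2 (R : realType) (x : R) : R := ln x / ln 2.

Section SubsetLaw.
Variables (R : realType) (X : finType).
Implicit Types (p r : R) (A C : {set X}).

Lemma subset_law_ge0 p A : 0 <= p <= 1 -> 0 <= subset_law p A.
Proof.
by move=> /andP[p0 p1]; apply: prodr_ge0 => x _; case: ifP; rewrite // subr_ge0.
Qed.

Lemma subset_law_sum1 p : \sum_(A : {set X}) subset_law p A = 1.
Proof.
rewrite -[RHS](@big1_eq _ _ *%R X (index_enum X) xpredT).
transitivity (\prod_(x : X) (p + (1 - p))); last by apply: eq_bigr => x _; ring.
by rewrite bigA_distr; apply: eq_bigr.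
Qed.

(* Probability that the union of A and an r-random subset is C. *)
Let kern r A C : R := \prod_(x : X)
  (if x \in A then (x \in C)%:R else if x \in C then r else 1 - r).

Let kern_ge0 r A C : 0 <= r <= 1 -> 0 <= kern r A C.
Proof.
move=> /andP[r0 r1]; apply: prodr_ge0 => x _.
by case: ifP => _; [rewrite ler0n | case: ifP; rewrite // subr_ge0].
Qed.

Let kern_sum1 r A : \sum_(C : {set X}) kern r A C = 1.
Proof.
rewrite -[RHS](@big1_eq _ _ *%R X (index_enum X) xpredT).
transitivity (\prod_(x : X) ((if x \in A then 1 else r) +
                             (if x \in A then 0 else 1 - r))); last first.
  by apply: eq_bigr => x _; case: ifP => _; ring.
rewrite bigA_distr; apply: eq_bigr => C _; apply: eq_bigr => x _.
by case: ifP; case: ifP.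
Qed.

Let kern_comp p r C :
  subset_law (p + (1 - p) * r) C = \sum_(A : {set X}) subset_law p A * kern r A C.
Proof.
transitivity (\prod_(x : X) (p * (x \in C)%:R +
                             (1 - p) * (if x \in C then r else 1 - r))).
  by apply: eq_bigr => x _; case: ifP => _ /=; ring.
rewrite bigA_distr; apply: eq_bigr => A _; rewrite -big_split /=.
by apply: eq_bigr => x _; case: ifP.
Qed.

Lemma subset_prob_lt (H : {set {set X}}) p r : nontrivial H ->
  0 <= p -> p < r -> r <= 1 ->
  subset_prob p (contains_edge H) < subset_prob r (contains_edge H).
Proof.
move=> /andP[/finset.set0Pn[S0 S0H] H0] p0 pr r1.
have p1 : p < 1 by exact: lt_le_trans r1.
have d0 : 0 < 1 - p by rewrite subr_gt0.
pose s := (r - p) / (1 - p).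
have s0 : 0 < s by rewrite divr_gt0 // subr_gt0.
have s1 : s <= 1 by rewrite ler_pdivrMr // mul1r lerD2r.
have s01 : 0 <= s <= 1 by rewrite (ltW s0).
have p01 : 0 <= p <= 1 by rewrite p0 ltW.
have -> : r = p + (1 - p) * s by rewrite /s; field; rewrite gt_eqF.
set F := contains_edge H.
have F0 : ~~ F finset.set0.
  apply/existsP => -[S /andP[SH]]; rewrite finset.subset0 => /eqP S_0.
  by rewrite -S_0 SH in H0.
have FT : F finset.setT by apply/existsP; exists S0; rewrite S0H finset.subsetT.
have -> : subset_prob (p + (1 - p) * s) F =
    \sum_(A : {set X}) subset_law p A * \sum_(C | F C) kern s A C.
  rewrite /subset_prob; under eq_bigr do rewrite kern_comp.
  by rewrite exchange_big /=; apply: eq_bigr => A _; rewrite mulr_sumr.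
rewrite [ltRHS](bigID F) /=.
rewrite -[ltLHS]addr0 ler_ltD //.
  apply: ler_sum => A FA.
  suff -> : \sum_(C | F C) kern s A C = 1 by rewrite mulr1.
  rewrite -(kern_sum1 s A) [RHS](bigID F) /= [X in _ = _ + X]big1 ?addr0 //.
  move=> C nFC.
  have /fintype.subsetPn[x xA xC] : ~~ (A \subset C).
    apply: contra nFC => AC; move/existsP: FA => [S /andP[SH SA]].
    by apply/existsP; exists S; rewrite SH (fintype.subset_trans SA).
  by rewrite /kern (bigD1 x) //= xA (negPf xC) mul0r.
rewrite (bigD1 finset.set0) //= ltr_pwDl //.
  apply: mulr_gt0.
    by apply: prodr_gt0 => x _; rewrite inE.
  rewrite (bigD1 finset.setT) //= ltr_pwDl //.
    by apply: prodr_gt0 => x _; rewrite !inE.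
  by apply: sumr_ge0 => C _; exact: kern_ge0.
apply: sumr_ge0 => A _; rewrite mulr_ge0 ?subset_law_ge0 //.
by apply: sumr_ge0 => C _; exact: kern_ge0.
Qed.

Lemma subset_prob_horner (E : pred {set X}) :
  {P : {poly R} | forall p, subset_prob p E = P.[p]}.
Proof.
exists (\sum_(A | E A) \prod_(x : X) (if x \in A then 'X else 1 - 'X)) => p.
rewrite horner_sum; apply: eq_bigr => A _.
by rewrite horner_prod; apply: eq_bigr => x _; case: ifP; rewrite !hornerE.
Qed.

Lemma threshold_unique (H : {set {set X}}) p r : nontrivial H ->
  is_threshold H p -> is_threshold H r -> p = r.
Proof.
move=> nH [/andP[p0 p1] pE] [/andP[r0 r1] rE].
have [pr|rp|//] := ltgtP p r.
  by have := subset_prob_lt nH p0 pr r1; rewrite pE rE ltxx.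
by have := subset_prob_lt nH r0 rp p1; rewrite pE rE ltxx.
Qed.

Lemma p_cP (H : {set {set X}}) : nontrivial H -> is_threshold H (p_c R H).
Proof.
move=> nH; rewrite /p_c; case: xgetP => [p _ //|no]; exfalso.
have [P PE] := subset_prob_horner (contains_edge H).
have /andP[/finset.set0Pn[S0 S0H] H0] := nH.
have P0 : P.[0] = 0.
  rewrite -PE; apply: big1 => A /existsP[S /andP[SH SA]].
  have [x xA] : exists x, x \in A.
    apply/finset.set0Pn; apply: contraNneq H0 => A0.
    by move: SA; rewrite A0 finset.subset0 => /eqP <-.
  by rewrite /subset_law (bigD1 x) //= xA mul0r.
have P1 : P.[1] = 1.
  rewrite -PE -[RHS](subset_law_sum1 1) [RHS](bigID (contains_edge H)) /=.
  rewrite [X in _ = _ + X]big1 ?addr0 // => A nA.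
  have /fintype.subsetPn[x _ xA] : ~~ (finset.setT \subset A).
    apply: contra nA => TA; apply/existsP; exists S0.
    by rewrite S0H (fintype.subset_trans _ TA) ?finset.subsetT.
  by rewrite /subset_law (bigD1 x) //= (negPf xA) subrr mul0r.
have [|||c c01 Pc] := @IVT R (horner P) 0 1 2^-1; first exact: ler01.
- by apply: continuous_subspaceT => x; exact: continuous_horner.
- rewrite P0 P1 min_l ?max_r ?ler01 //; lra.
- by apply: (no c); split; [rewrite in_itv in c01 | rewrite PE].
Qed.

Lemma q_expectationP (H : {set {set X}}) : nontrivial H ->
  0 < q_expectation R H < 1 /\ q_small H (q_expectation R H).
Proof.
move=> nH; have /andP[/finset.set0Pn[S0 S0H] H0] := nH.
pose cov (G : {set {set X}}) := (H \subset upclosure G) && (finset.set0 \notin G).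
have cov_neq0 G : cov G -> exists S, S \in G.
  move=> /andP[/fintype.subsetP/(_ _ S0H)]; rewrite inE => /existsP[S /andP[SG _]].
  by exists S.
have card_gt0 G S : cov G -> S \in G -> (0 < #|S|)%N.
  move=> /andP[_ G0] SG; rewrite card_gt0; apply: contraNneq G0 => <-.
  exact: SG.
have wP (G : {set {set X}}) : exists c : R, cov G ->
    [/\ 0 < c < 1, \sum_(S in G) c ^+ #|S| <= 2^-1 &
     forall q : R, 0 < q -> \sum_(S in G) q ^+ #|S| <= 2^-1 -> q <= c].
  have [cG|] := boolP (cov G); last by exists 0.
  pose P : {poly R} := \sum_(S in G) 'X ^+ #|S|.
  have PE q : P.[q] = \sum_(S in G) q ^+ #|S|.
    by rewrite horner_sum; apply: eq_bigr => S _; rewrite !hornerE.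
  have P0 : P.[0] = 0.
    rewrite PE big1 // => S SG; rewrite expr0n.
    by rewrite eqn0Ngt (card_gt0 _ _ cG SG).
  have [S1 S1G] := cov_neq0 _ cG.
  have P1 : 1 <= P.[1].
    rewrite PE (bigD1 S1) //= expr1n lerDl; apply: sumr_ge0 => S _.
    by rewrite expr1n.
  have [|||c] := @IVT R (horner P) 0 1 2^-1; first exact: ler01.
  - by apply: continuous_subspaceT => x; exact: continuous_horner.
  - have P01 : P.[0] <= P.[1] by rewrite P0 (le_trans ler01).
    rewrite (min_l P01) (max_r P01) P0; apply/andP; split; first by lra.
    by apply: le_trans P1; lra.
  rewrite in_itv /= => /andP[c0 c1] Pc.
  have {}c0 : 0 < c.
    by rewrite lt_def c0 andbT; apply: contra_eq_neq Pc => ->; rewrite P0; lra.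
  have {}c1 : c < 1.
    rewrite lt_def c1 andbT; apply/eqP => c1'.
    by move: P1; rewrite c1' Pc; lra.
  exists c => _; split; first by rewrite c0.
    by rewrite -PE Pc.
  move=> q q0; apply: contraTT; rewrite -!ltNge => cq; rewrite -Pc PE.
  rewrite (bigD1 S1) //= [ltRHS](bigD1 S1) //= ltr_leD //.
    by rewrite ltrXn2r ?(ltW c0) ?(ltW q0) // -lt0n (card_gt0 _ _ cG).
  by apply: ler_sum => S _; rewrite lerXn2r ?nnegrE ?ltW.
have [w {}wP] := boolp.choice wP.
have covH : cov H.
  rewrite /cov H0 andbT; apply/fintype.subsetP => S SH.
  by rewrite inE; apply/existsP; exists S; rewrite SH subxx.
have [G cG Gmax] := arg_maxP w covH.
have [wG01 wGs _] := wP _ cG.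
set E := [set q : R | 0 < q < 1 /\ q_small H q]%classic.
have EwG : E (w G) by split=> //; exists G; case/andP: cG.
have ubE : ubound E (w G).
  move=> q [/andP[q0 _] [G' [HG' G's]]].
  have cG' : cov G'.
    rewrite /cov HG' /=; apply/negP => G'0; move: G's.
    rewrite (bigD1 finset.set0) //= cards0 expr0 => le2.
    have : 0 <= \sum_(S in G' | S != finset.set0) q ^+ #|S|.
      by apply: sumr_ge0 => S _; rewrite exprn_ge0 // ltW.
    by move: le2; lra.
  by have [_ _ /(_ q q0 G's)] := wP _ cG'; move/le_trans; apply; exact: Gmax.
suff -> : q_expectation R H = w G by exact: EwG.
apply/eqP; rewrite eq_le; apply/andP; split.
  by apply: ge_sup => //; exists (w G).
by apply: ub_le_sup => //; exists (w G).
Qed.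

End SubsetLaw.

(* Main.v *)
(** For a random [W], let the fragments of [H] be the inclusion-minimal sets
    among the [S :\: W], [S \in H].  They cover [H].  If all edges have size
    [< 2m], the fragments of size [>= m] are cheap on average: for a fragment [T]
    of [W], put [Z = W :|: T]; any edge contained in [Z] contains [T], so [Z]
    determines [T] up to [2 ^ (2m - 2)] choices, while for an [8q]-random set the
    probability of [W] times [q ^ #|T|] is at most the probability of [Z] times
    [8 ^- #|T|].  The smaller fragments have size [< m] and are
    handled by the next independent [8q]-random set.  After [k] rounds, [2 ^ k]
    exceeding every edge size, only the empty fragment is possible, so whenever no
    edge was hit the large fragments met on the way cover [H] and cost [>= 1/2];
    their expected total cost is [< 1/4], so this has probability [< 1/2]. *)
Require Import Defs.
From mathcomp Require Import all_boot all_order all_algebra.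
From mathcomp Require Import all_classical all_reals all_analysis.
From mathcomp Require Import ring lra.

Import Order.TTheory GRing.Theory Num.Theory.
Import fintype boot.finset.
Local Open Scope ring_scope.

(** * Density of a union of [n] independent [x]-random sets *)

Lemma onem_expr_itv01 (R : realType) (x : R) n :
  0 <= x <= 1 -> 0 <= 1 - (1 - x) ^+ n <= 1.
Proof.
move=> x01; have /andP[h0 h1] : 0 <= 1 - x <= 1 by lra.
by rewrite subr_ge0 exprn_ile1 //= gerBl exprn_ge0.
Qed.

Lemma onem_expr_le (R : realType) (x : R) n :
  0 <= x <= 1 -> 1 - (1 - x) ^+ n <= x * n%:R.
Proof.
move=> x01; elim: n => [|n IH]; first by rewrite expr0 mulr0 subrr.
have /andP[] := onem_expr_itv01 R x n x01.
rewrite exprS -(natr1 n); nra.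
Qed.

Section RandomSubsets.
Set Implicit Arguments.
Unset Strict Implicit.

Variables (R : realType) (X : finType).
Implicit Types (H : {set {set X}}) (p q r : R)
  (A B C S T W Z : {set X}) (E : pred {set X}).

(** * Unions of independent random subsets *)

Lemma subset_law_union p r C :
  subset_law (p + (1 - p) * r) C =
  \sum_A subset_law p A * \sum_(B | A :|: B == C) subset_law r B.
Proof.
transitivity (\sum_A subset_law p A *
  \prod_(x : X) (r * ((x \in C)%:R) + (1 - r) * (((x \in A) == (x \in C))%:R))).
  transitivity (\prod_(x : X) (p * (x \in C)%:R +
      (1 - p) * (if x \in C then r else 1 - r))).
    by apply: eq_bigr => x _; case: ifP => _ /=; ring.
  rewrite bigA_distr; apply: eq_bigr => A _; rewrite -big_split /=.
  by apply: eq_bigr => x _; case: (x \in A); case: (x \in C) => /=; ring.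
apply: eq_bigr => A _; congr (_ * _).
rewrite bigA_distr [RHS]big_mkcond /=; apply: eq_bigr => B _.
have [<-|neq] := eqVneq (A :|: B) C.
  apply: eq_bigr => x _; rewrite in_setU.
  by case: (x \in A); case: (x \in B); rewrite /= mulr1.
have [x xP] : exists x, (x \in A :|: B) != (x \in C).
  apply/existsP; apply: contraNT neq; rewrite negb_exists => /forallP h.
  by apply/eqP/setP => x; apply/eqP/negPn/h.
rewrite (bigD1 x) //=; move: xP; rewrite in_setU.
by case: (x \in A); case: (x \in B); case: (x \in C) => //= _;
  rewrite mulr0 mul0r.
Qed.

Lemma subset_prob_union p r E :
  subset_prob (p + (1 - p) * r) E =
  \sum_A subset_law p A * subset_prob r (fun B => E (A :|: B)).
Proof.
rewrite /subset_prob; under eq_bigr do rewrite subset_law_union.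
rewrite exchange_big /=; apply: eq_bigr => A _; rewrite -mulr_sumr; congr (_ * _).
rewrite (exchange_big_dep (fun B => E (A :|: B))) /=; last first.
  by move=> C B EC /eqP ->.
by apply: eq_bigr => B EB; rewrite (big_pred1 (A :|: B)) // => C /=;
  rewrite eq_sym; case: eqP => [->|]; rewrite ?andbT ?andbF.
Qed.

Lemma subset_prob_mono p E E' : 0 <= p <= 1 -> subpred E E' ->
  subset_prob p E <= subset_prob p E'.
Proof.
move=> p01 EE'; rewrite /subset_prob big_mkcond [leRHS]big_mkcond /=.
apply: ler_sum => A _; have := @subset_law_ge0 R X p A p01.
by case: ifPn => [/EE' ->//|_]; case: ifP.
Qed.

Lemma subset_probC p E : subset_prob p (predC E) = 1 - subset_prob p E.
Proof.
rewrite -(@subset_law_sum1 R X p) [X in _ = X - _](bigID E) /= /subset_prob.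
by rewrite addrAC subrr add0r.
Qed.

Lemma subset_prob_le1 p E : 0 <= p <= 1 -> subset_prob p E <= 1.
Proof.
move=> p01; rewrite -(@subset_law_sum1 R X p).
exact: (@subset_prob_mono p E xpredT).
Qed.

(** Only the factors at points of [T] differ: [(1 - p) * p] on the left, [p] on the right. *)
Lemma subset_law_disjointU p W T : 0 <= p <= 1 -> [disjoint W & T] ->
  subset_law p W * p ^+ #|T| <= subset_law p (W :|: T).
Proof.
move=> /andP[p0 p1] dWT; rewrite -prodr_const big_mkcond -big_split /=.
apply: ler_prod => x _; rewrite in_setU.
move: (@disjointFr _ _ _ x dWT).
case: (x \in W) => [->//|_] /=; first by rewrite mulr1 p0 lexx.
case: (x \in T) => /=; last by rewrite mulr1 lexx subr_ge0 p1.
by rewrite mulr_ge0 ?subr_ge0 //= ler_piMl // lerBlDr lerDl.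
Qed.

(* Complementation in [S] maps these subsets to subsets of size [< m]; the factor
   2 gained this way is what makes the constant 8 suffice. *)
Lemma card_subsets_upper_half S m :
  (0 < m)%N -> (#|S| < m.*2)%N ->
  (#|[set T : {set X} | T \subset S & (m <= #|T|)%N]| * 2 <= 2 ^ m.*2.-1)%N.
Proof.
move=> m0 Sm; set U := [set T | _ & _].
pose V := [set S :\: T | T in U].
have cV : #|V| = #|U|.
  apply: card_in_imset => A B; rewrite !inE => /andP[AS _] /andP[BS _] e.
  have K (C : {set X}) : C \subset S -> S :\: (S :\: C) = C.
    by move=> /setIidPr CS; rewrite setDDr setDv set0U.
  by rewrite -(K A AS) e K.
have dUV : [disjoint U & V].
  apply/pred0P => T /=; apply/negP => /andP[TU /imsetP[T' T'U eT]].
  move: TU T'U; rewrite !inE => /andP[_ mT] /andP[T'S mT'].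
  move: mT; rewrite eT cardsD (setIidPr T'S) leqNgt => /negP; apply.
  by rewrite ltn_subLR ?subset_leq_card // (leq_trans Sm) // -addnn leq_add2r.
rewrite muln2 -addnn -{2}cV -cardsUI (disjoint_setI0 dUV) cards0 addn0.
apply: (@leq_trans (2 ^ #|S|)); last by rewrite leq_exp2l // -ltnS prednK ?double_gt0.
rewrite -card_powerset; apply: subset_leq_card; apply/subsetP => T.
rewrite in_setU powersetE => /orP[|/imsetP[T' _ ->]]; last exact: subsetDl.
by rewrite inE => /andP[].
Qed.

(** * Fragments and their expected cost *)

Definition fragments H W : {set {set X}} :=
  [set T | minset (mem [set S :\: W | S in H]) T].

Lemma fragmentsP H W T : T \in fragments H W -> exists2 S, S \in H & T = S :\: W.
Proof. by rewrite inE => /minsetp /imsetP. Qed.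

Lemma fragment_sub_edge H W S : S \in H ->
  exists2 T, T \in fragments H W & T \subset S.
Proof.
move=> SH; have : S :\: W \in [set S :\: W | S in H] by exact: imset_f.
move=> /(@minset_exists X (mem [set S :\: W | S in H])) [T minT TS].
by exists T; rewrite ?inE // (subset_trans TS) ?subsetDl.
Qed.

(** [S :\: W] lies inside [T], so by minimality it equals [T]. *)
Lemma fragment_min H W S T : T \in fragments H W -> S \in H ->
  S \subset W :|: T -> T \subset S.
Proof.
rewrite inE => /minsetP[_ Tmin] SH SWT.
rewrite -(Tmin (S :\: W)) ?subsetDl ?subDset //; exact: imset_f.
Qed.

(** Fix one edge [S] inside [Z]. By [fragment_min] every [T] occurring is a large subset of this
    same [S], and [W] is recovered as [Z :\: T]. *)
Lemma card_large_fragments H m Z : (0 < m)%N ->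
  {in H, forall S, (#|S| < m.*2)%N} ->
  (#|[set u : {set X} * {set X} |
      [&& u.2 \in fragments H u.1, m <= #|u.2| & u.1 :|: u.2 == Z]]| * 2
    <= 2 ^ m.*2.-1)%N.
Proof.
move=> m0 Hm; set U := [set u | _].
have disj W T : T \in fragments H W -> (W :|: T) :\: T = W.
  move=> /fragmentsP[S _ ->]; apply/setP => x; rewrite !inE.
  by case: (x \in W); case: (x \in S).
have UP u : u \in U ->
    [/\ u.2 \in fragments H u.1, (m <= #|u.2|)%N & u.1 :|: u.2 = Z].
  by rewrite inE => /and3P[? ? /eqP].
have [->|[u0 /UP[/fragmentsP[S SH eS] _ Z0]]] := set_0Vmem U.
  by rewrite cards0.
have SZ : S \subset Z by rewrite -Z0 -subDset eS.
apply: leq_trans (card_subsets_upper_half m0 (Hm _ SH)).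
rewrite leq_mul2r /= -(card_in_imset (f := snd) (D := U)); last first.
  move=> [W T] [W' T'] /UP[/= /disj WT _ e] /UP[/= /disj WT' _ e'] TT'.
  by rewrite -WT -WT' e e' TT'.
apply: subset_leq_card; apply/subsetP => _ /imsetP[[W T] /UP[/= TF mT WTZ] ->].
by rewrite inE mT andbT (fragment_min TF) ?WTZ.
Qed.

Lemma large_fragments_cost q H m : 0 <= q -> 8 * q <= 1 -> (0 < m)%N ->
  {in H, forall S, (#|S| < m.*2)%N} ->
  \sum_W subset_law (8 * q) W *
    \sum_(T in fragments H W | (m <= #|T|)%N) q ^+ #|T| <= 2^-1 ^+ m.+2 :> R.
Proof.
move=> q0 q1 m0 Hm.
have p01 : 0 <= 8 * q <= 1 by rewrite q1 mulr_ge0.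
pose P (u : {set X} * {set X}) := (u.2 \in fragments H u.1) && (m <= #|u.2|)%N.
pose c : R := 8^-1 ^+ m.
apply: (@le_trans _ _ (\sum_(u | P u) subset_law (8 * q) (u.1 :|: u.2) * c)).
  under eq_bigr do rewrite mulr_sumr.
  rewrite pair_big_dep /=; apply: ler_sum => -[W T] /= /andP[TF mT].
  have dWT : [disjoint W & T].
    have [S _ ->] := fragmentsP TF.
    by rewrite -setI_eq0; apply/eqP/setP => x; rewrite !inE; case: (x \in W).
  have -> : q ^+ #|T| = (8 * q) ^+ #|T| * 8^-1 ^+ #|T|.
    by rewrite -exprMn; congr (_ ^+ _); field.
  rewrite mulrA.
  apply: ler_pM (subset_law_disjointU p01 dWT) _.
  - by rewrite mulr_ge0 ?subset_law_ge0 ?exprn_ge0 ?mulr_ge0.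
  - by rewrite exprn_ge0.
  - by rewrite ler_wiXn2l //; lra.
rewrite (partition_big (fun u => u.1 :|: u.2) xpredT) //=.
rewrite -[leRHS]mul1r -[X in _ <= X * _](@subset_law_sum1 R X (8 * q)) mulr_suml.
apply: ler_sum => Z _.
rewrite (eq_bigr (fun=> subset_law (8 * q) Z * c)); last first.
  by move=> u /= /andP[_ /eqP <-].
rewrite sumr_const -mulrnAr ler_wpM2l ?subset_law_ge0 //.
rewrite -cardsE; have := card_large_fragments Z m0 Hm.
set U := [set _ | _]; set V := [set _ | _].
have -> : U = V by apply/setP => u; rewrite [LHS]in_set [RHS]in_set andbA.
(* With [m = n + 1], at most [4 ^ n] pairs share the union [Z], each weighted [8 ^- (n + 1)]; the
   product is [2 ^- (n + 3)]. *)
case: m m0 @c {Hm P U} V => // n _ c V; rewrite doubleS /= expnSr leq_mul2r /=.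
rewrite -mul2n expnM => VS; rewrite -mulr_natl.
apply: (@le_trans _ _ ((4 ^ n)%N%:R * c)).
  by rewrite ler_wpM2r ?ler_nat // exprn_ge0.
rewrite natrX /c exprS mulrCA -exprMn !exprSr.
have -> : 4 * 8^-1 = 2^-1 :> R by field.
by rewrite mulrC -!mulrA ler_wpM2l ?exprn_ge0 //; lra.
Qed.

(* [d] is the cost already spent on large fragments in the earlier rounds. *)
Lemma subset_prob_avoid_le q j H d : 0 <= q -> 8 * q <= 1 -> 0 <= d ->
  {in H, forall S, (#|S| < 2 ^ j)%N} ->
  (forall G, H \subset upclosure G -> 2^-1 - d <= \sum_(S in G) q ^+ #|S|) ->
  subset_prob (1 - (1 - 8 * q) ^+ j) (predC (contains_edge H)) <=
    2 * d + 2^-1 * (1 - 2^-1 ^+ j).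
Proof.
move=> q0 q1; have p01 : 0 <= 8 * q <= 1 by rewrite q1 mulr_ge0.
elim: j H d => [|j IH] H d d0 Hj cost.
  (* No edge has a point. Either [set0] is an edge and cannot be avoided, or [H] is empty and its
     empty cover forces [d >= 1/2]. *)
  rewrite !expr0 !subrr mulr0 addr0.
  have [H0|H0] := boolP (set0 \in H).
    rewrite /subset_prob big_pred0 ?mulr_ge0 // => A /=.
    by apply/negbF/existsP; exists set0; rewrite H0 sub0set.
  have HE : H = set0.
    apply/setP => S; rewrite inE; apply/negP => SH.
    by have := Hj _ SH; rewrite ltnS leqn0 cards_eq0 => /eqP S0; rewrite -S0 SH in H0.
  move: cost; rewrite HE => /(_ set0 (sub0set _)); rewrite big_set0.
  have := @subset_prob_le1 0 (predC (contains_edge set0)); lra.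
set r := 1 - (1 - 8 * q) ^+ j in IH *.
have -> : 1 - (1 - 8 * q) ^+ j.+1 = 8 * q + (1 - 8 * q) * r.
  by rewrite /r exprS; ring.
rewrite subset_prob_union; pose m := (2 ^ j)%N.
have m0 : (0 < m)%N by rewrite expn_gt0.
have Hm : {in H, forall S, (#|S| < m.*2)%N}.
  by move=> S /Hj; rewrite expnS mul2n.
pose z W := \sum_(T in fragments H W | (m <= #|T|)%N) q ^+ #|T|.
apply: (@le_trans _ _ (\sum_W subset_law (8 * q) W *
    (2 * (d + z W) + 2^-1 * (1 - 2^-1 ^+ j)))).
  apply: ler_sum => W _; rewrite ler_wpM2l ?subset_law_ge0 //.
  (* If [B] contains a small fragment [S :\: W], then [W :|: B] contains [S]; so avoiding [H] forces
     [B] to avoid [H']. *)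
  pose H' := [set T in fragments H W | (#|T| < m)%N].
  apply: le_trans (IH H' (d + z W) _ _ _).
  - apply: subset_prob_mono => [|B /=]; first exact: onem_expr_itv01.
    apply: contra.
    move=> /existsP[T /andP[]]; rewrite in_set => /andP[/fragmentsP[S SH ->] _] SB.
    by apply/existsP; exists S; rewrite SH -subDset.
  - by rewrite addr_ge0 // sumr_ge0 // => T _; rewrite exprn_ge0.
  - by move=> T; rewrite in_set => /andP[].
  (* Adding the large fragments [L] to a cover of [H'] gives a cover of [H], at extra cost at most
     [z W]. *)
  - move=> G H'G; pose L := [set T in fragments H W | (m <= #|T|)%N].
    have zE : z W = \sum_(T in L) q ^+ #|T|.
      by rewrite /z; apply: eq_bigl => T; rewrite [RHS]in_set.
    have: 2^-1 - d <= \sum_(S in G :|: L) q ^+ #|S|.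
      apply: cost; apply/subsetP => S SH.
      have [T TF TS] := fragment_sub_edge W SH; rewrite in_set.
      have [mT|Tm] := leqP m #|T|.
        by apply/existsP; exists T; rewrite in_setU TS in_set TF mT orbT.
      have : T \in upclosure G by apply: (subsetP H'G); rewrite in_set TF.
      rewrite in_set => /existsP[S' /andP[S'G S'T]].
      by apply/existsP; exists S'; rewrite in_setU S'G (subset_trans S'T).
    have : \sum_(S in G :|: L) q ^+ #|S| <= \sum_(S in G) q ^+ #|S| + z W.
      rewrite zE (big_setID G) /= setUK setDUl setDv set0U lerD2l.
      rewrite [leRHS](big_setID G) /= lerDr.
      by apply: sumr_ge0 => T _; rewrite exprn_ge0.
    lra.
have zcost := large_fragments_cost q0 q1 m0 Hm.
have -> : \sum_W subset_law (8 * q) W *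
    (2 * (d + z W) + 2^-1 * (1 - 2^-1 ^+ j)) =
    2 * d + 2^-1 * (1 - 2^-1 ^+ j) + 2 * \sum_W subset_law (8 * q) W * z W.
  rewrite -[X in _ = X + _]mulr1 -[X in _ = _ * X + _](@subset_law_sum1 R X (8 * q)).
  by rewrite !mulr_sumr -big_split /=; apply: eq_bigr => W _; ring.
(* As [m = 2 ^ j >= j + 1], the round adds at most [2 * 2 ^- (j + 3)], exactly the growth of
   [(1 - 2 ^- j) / 2] from [j] to [j + 1]. *)
have : 2^-1 ^+ m.+2 <= 2^-1 ^+ j.+3 :> R.
  by rewrite ler_wiXn2l ?invr_ge0 // ?invf_le1 // ?ler1n // !ltnS ltn_expl.
move: zcost; rewrite !exprS.
set t := 2^-1 ^+ j; lra.
Qed.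

End RandomSubsets.

Theorem theorem2 (R : realType) (X : finType) (H : {set {set X}}) :
  nontrivial H ->
  p_c R H <= 8 * q_expectation R H * log2 (2 * (ell H)%:R : R).
Proof.
move=> nH; have /andP[/set0Pn[S0 S0H] H0] := nH.
have [/andP[pc0 pc1] pcE] := p_cP R nH.
have [/andP[q0 q1] _] := q_expectationP R nH.
set l := ell H; set L := log2 _; set Q := q_expectation R H in q0 q1 *.
have lP S : S \in H -> (#|S| <= l)%N.
  by move=> SH; rewrite /l /ell (bigD1 S) //= leq_maxl.
have l0 : (0 < l)%N.
  apply: leq_trans (lP _ S0H).
  by rewrite card_gt0; apply: contraNneq H0 => <-.
(* The number of rounds: [l < 2 ^ k <= 2 * l], hence [k <= L]. *)
pose k := (trunc_log 2 l).+1.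
have lk : (l < 2 ^ k)%N by exact: trunc_log_ltn.
have kL : k%:R <= L.
  rewrite /L /log2 ler_pdivlMr ?ln_gt0 ?ltr1n // [leLHS]mulr_natl -lnXn //.
  rewrite ler_ln ?posrE ?exprn_gt0 ?mulr_gt0 ?ltr0n //.
  by rewrite -natrX -natrM ler_nat expnS leq_mul2l /= trunc_logP.
have L1 : 1 <= L by apply: le_trans kL; rewrite ler1n.
rewrite leNgt; apply/negP => pcL.
have L0 : 0 < 8 * L by lra.
(* Above [Q], [q] admits no cover of cost at most 1/2; below the other bound, [k] rounds still have
   density less than [p_c]. *)
have [q /andP[Qq qpc]] : exists q, Q < q < p_c R H / (8 * L).
  have QL : Q < p_c R H / (8 * L).
    by rewrite ltr_pdivlMr // mulrCA mulrA.
  by exists ((Q + p_c R H / (8 * L)) / 2); rewrite !midf_lt.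
move: qpc; rewrite ltr_pdivlMr // => qpc.
have {}q0 : 0 < q by exact: lt_trans Qq.
have q8 : 8 * q <= 1 by nra.
have cost G : H \subset upclosure G -> 2^-1 - 0 <= \sum_(S in G) q ^+ #|S|.
  rewrite subr0 => HG; rewrite leNgt; apply/negP => /ltW small.
  have : q <= Q; last by rewrite leNgt Qq.
  apply: ub_le_sup; first by exists 1 => r [/andP[_ /ltW]].
  by split; [rewrite q0 /=; lra | exists G].
have Hk : {in H, forall S : {set X}, (#|S| < 2 ^ k)%N}.
  by move=> S /lP Sl; exact: leq_ltn_trans lk.
have := subset_prob_avoid_le (ltW q0) q8 (lexx 0) Hk cost.
set p := 1 - _ ^+ k; rewrite subset_probC mulr0 add0r.
have p01 : 0 <= p <= 1.
  by apply: onem_expr_itv01; rewrite q8 mulr_ge0 // ltW.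
have p_pc : p < p_c R H.
  apply: le_lt_trans qpc; apply: (@le_trans _ _ (8 * q * k%:R)); last first.
    by rewrite mulrCA mulrA ler_wpM2l // mulr_ge0 // ltW.
  by apply: onem_expr_le; rewrite q8 mulr_ge0 // ltW.
(* At [p < p_c] an edge is hit with probability below 1/2, whereas the rounds bound the avoidance
   probability by [(1 - 2 ^- k) / 2]. *)
have := subset_prob_lt nH (andP p01).1 p_pc pc1; rewrite pcE.
have : 0 < 2^-1 ^+ k :> R by rewrite exprn_gt0.
move: (subset_prob _ _) (2^-1 ^+ k) => a b; lra.
Qed.
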